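(* Let $X$ be a metric space. Suppose there is a $1$-Lipschitz map $u:X\to\mathbb{R}$ and a constant $C\in(0,\infty)$ such that for every interval $I\subset\mathbb{R}$, the $\operatorname{diam}(I)$-components of $u^{-1}(I)$ have diameter at most $C\cdot\operatorname{diam}(I)$. Then $X$ admits a bilipschitz embedding $f:X\to L_1$.
   Context: Here $L_1$ means $L_1(Z,\mu)$ for some measure space $(Z,\mu)$. For a metric space $W$ and $\delta\in(0,\infty)$, a $\delta$-path (or $\delta$-chain) in $W$ is a finite sequence $w_0,\dots,w_k\in W$ with $d(w_{i-1},w_i)\le\delta$ for all $i\in\{1,\dots,k\}$. Being joined by a $\delta$-path is an equivalence relation on $W$, whose equivalence classes are the $\delta$-components of $W$. (The condition on $I$ is only nontrivial for bounded intervals of positive length.) A map $f$ is a bilipschitz embedding if there is $L\ge1$ with $L^{-1}d(x,x')\le d(f(x),f(x'))\le L\,d(x,x')$ for all $x,x'$. *)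

(* Defs.v *)
From HB Require Import structures.
From mathcomp Require Import all_boot all_order all_algebra.
From mathcomp Require Import all_classical all_reals all_analysis.
From mathcomp Require Import measurable_realfun.

Set Implicit Arguments.
Unset Strict Implicit.
Unset Printing Implicit Defensive.

Import Order.TTheory GRing.Theory Num.Theory.
Import numFieldNormedType.Exports.

Local Open Scope classical_set_scope.
Local Open Scope ring_scope.

Section MetricNotions.
Context {R : realType}.

(* The join with 0 only matters for A = set0, whose diameter is 0. *)
Definition diam {X : metricType R} (A : set X) : \bar R :=
  maxe 0%E (ereal_sup [set (mdist p.1 p.2)%:E | p in A `*` A]).

Definition klipschitz {X Y : metricType R} (k : R) (f : X -> Y) : Prop :=
  forall x x', mdist (f x) (f x') <= k * mdist x x'.

Definition bilipschitz_embedding {X Y : metricType R} (f : X -> Y) : Prop :=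
  exists2 L : R, 1 <= L &
    forall x x', L^-1 * mdist x x' <= mdist (f x) (f x') <= L * mdist x x'.

(* The sequence w_0, ..., w_k is given as its head w and its tail s. The scale
   delta is extended so that it can be the diameter of an unbounded set. *)
Definition delta_path {X : metricType R} (delta : \bar R) (W : set X)
    (w : X) (s : seq X) : Prop :=
  {in w :: s, forall v, W v} /\
  path (fun a b => (mdist a b)%:E <= delta)%E w s.

Definition delta_joined {X : metricType R} (delta : \bar R) (W : set X)
    (x y : X) : Prop :=
  exists2 s, delta_path delta W x s & last x s = y.

Definition delta_component {X : metricType R} (delta : \bar R) (W : set X)
    (A : set X) : Prop :=
  exists2 x, W x & A = [set y | delta_joined delta W x y].

End MetricNotions.

Section L1.
Context d (Z : measurableType d) (R : realType).
Variable mu : {measure set Z -> \bar R}.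

(* Elements are classes of functions modulo almost everywhere equality. *)
Definition L1 : Type := LspaceType1 mu.

HB.instance Definition _ := gen_eqMixin L1.
HB.instance Definition _ := gen_choiceMixin L1.

(* A representative of the class f. *)
Definition L1_fun (f : L1) : {mfun Z >-> measurableTypeR R} :=
  repr (LebesgueSpace.sort f).

Definition L1_dist (f g : L1) : R :=
  fine ('N[mu]_1 [EFin \o (L1_fun f \- L1_fun g)%R])%E.

Lemma measurable_L1_fun (f : L1) : measurable_fun setT (L1_fun f : Z -> R).
Proof. exact: (@measurable_funPT _ _ _ _ (L1_fun f)). Qed.

Lemma measurable_L1_funB (f g : L1) :
  measurable_fun setT (L1_fun f \- L1_fun g : Z -> R).
Proof. by apply: measurable_funB; exact: measurable_L1_fun. Qed.

Lemma L1_fun_finite_norm (f : L1) : finite_norm mu 1 (L1_fun f : Z -> R).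
Proof. exact: (@Lebesgue_finite _ _ _ _ _ _ f). Qed.

Lemma L1_distE (f g : L1) :
  (L1_dist f g)%:E = (\int[mu]_z `|(L1_fun f z - L1_fun g z)%:E|)%E.
Proof.
rewrite -[RHS]Lnorm1 /L1_dist fineK// fin_numElt.
rewrite (lt_le_trans ltNy0) ?Lnorm_ge0//=.
have mNg : measurable_fun setT (\- L1_fun g : Z -> R).
  exact: measurableT_comp (measurable_L1_fun g).
have := eminkowski mu (measurable_L1_fun f) mNg (lexx _).
move=> /le_lt_trans; apply; rewrite lte_add_pinfty//.
  exact: L1_fun_finite_norm.
rewrite (_ : EFin \o _ = \- (EFin \o L1_fun g))%E// oppe_Lnorm.
exact: L1_fun_finite_norm.
Qed.

Let L1_distxx f : L1_dist f f = 0.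
Proof.
apply: EFin_inj; rewrite L1_distE.
under eq_integral do rewrite subrr abse0.
exact: integral0.
Qed.

Let L1_dist_positivity f g : L1_dist f g = 0 -> f = g.
Proof.
move=> fg0; have : ('N[mu]_1 [EFin \o (L1_fun f \- L1_fun g)%R] = 0)%E.
  by rewrite Lnorm1 -[LHS]L1_distE fg0.
have /measurable_EFinP mfg := measurable_L1_funB f g.
move=> /(Lnorm_eq0_eq0 mfg lte01) {mfg fg0} fg.
have {fg} : L1_fun f = L1_fun g %[ae mu].
  by apply: filterS fg => z /(_ I) [] /eqP; rewrite subr_eq0 => /eqP.
move=> /(@ae_eqP _ _ R Z (measurableTypeR R) mu
  (LebesgueSpace.sort f) (LebesgueSpace.sort g)) /eqP.
rewrite !reprK.
case: f g => [f [[pf]]] [g [[pg]]] /= fg; case: _ / fg in pg *.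
by rewrite (Prop_irrelevance pf pg).
Qed.

Let L1_dist_sym f g : L1_dist f g = L1_dist g f.
Proof.
apply: EFin_inj; rewrite !L1_distE.
by apply: eq_integral => z _; rewrite /= distrC.
Qed.

Let L1_dist_triangle g f h : L1_dist f h <= L1_dist f g + L1_dist g h.
Proof.
rewrite -lee_fin EFinD !L1_distE -!Lnorm1.
have := eminkowski mu (measurable_L1_funB f g) (measurable_L1_funB g h) (lexx _).
by congr (_ <= _)%E; apply: eq_Lnorm => z /=; rewrite addrA subrK.
Qed.

HB.instance Definition _ := @isMetric.Build R L1 L1_dist
  L1_distxx L1_dist_positivity L1_dist_sym L1_dist_triangle.

Lemma L1_mdistE (f g : L1) :
  (mdist f g)%:E = (\int[mu]_z `|(L1_fun f z - L1_fun g z)%:E|)%E.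
Proof. exact: L1_distE. Qed.

End L1.

(* Main.v *)
Require Import Defs.
From HB Require Import structures.
From mathcomp Require Import all_boot all_order all_algebra.
From mathcomp Require Import finmap.
From mathcomp Require Import all_classical all_reals all_analysis.
From mathcomp Require Import measurable_realfun.
From mathcomp Require Import zify ring lra.

Set Implicit Arguments.
Unset Strict Implicit.
Unset Printing Implicit Defensive.

Import Order.TTheory GRing.Theory Num.Theory.
Import numFieldNormedType.Exports.

Local Open Scope classical_set_scope.
Local Open Scope ring_scope.

(** The embedding is given by random cuts of [X], that is, by random sets that
    contain the points lying above a random threshold. Measurable sets at finite
    distance from a fixed one, with the measure of the symmetric difference as
    the distance, sit isometrically in [L1] (lemma [cuts_embed_L1]), so what is
    needed is a family of cuts, indexed by the points of [X], such that two
    points [x], [y] are separated with measure comparable to their distance.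

    Thresholding [u] at a real number [s] chosen by Lebesgue measure separates
    [x] and [y] with measure [`|u x - u y|], which is enough unless [u] takes
    almost the same value at two distant points. In that case the hypothesis
    puts [x] and [y] in different components of a slab [u^-1(I)] with [diam I]
    comparable to their distance, and the remedy is to let each component of
    each slab modify the threshold independently. Fix a nested sequence of
    dyadic grids. The threshold [s] is read off digit by digit: at level [j] a
    point still undecided, meaning that the threshold lies in the same cell of
    side [2 ^ - j] as [u x], consults a fair coin attached to its
    [2 ^ - j]-component of the slab over that cell. The coin says whether the
    two halves of the cell are to be exchanged. If the (possibly exchanged)
    threshold then lies in the half not containing [u x], the point [x] is
    decided: it is above the threshold exactly when [u x] is in the upper half.

    For fixed coins, exchanging halves preserves Lebesgue measure, so the set
    of those [s] that leave [x] undecided down to level [k] is again a cell of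
    level [k], of measure [2 ^ - k] (lemma [active_cell]). Both estimates rest
    on this.
    - Upper bound. If [mdist x y <= 2 ^ - k], then [x] and [y] consult the same
      coins as long as they share a cell. Once their cells part, they are
      adjacent, so the digits of one are 0111... and those of the other are
      1000..., and all decisions taken before level [k] agree. Hence a threshold
      separating them leaves one of them undecided down to level [k]
      (lemma [above_close]).
    - Lower bound. Let [j] be the first level where [x] and [y] lie in different
      components. With probability one half their coins differ, and then some
      cell of thresholds of comparable size separates them, provided that
      [u x] and [u y] share a cell and are not close to its ends
      (lemma [separating_cell]).
    The proviso holds for one of two grids whose end points stay far from each
    other (lemma [well_placed_grid]), so the embedding combines the cuts coming
    from both grids with the thresholds of [u] itself.

    Two points need care. The components may be uncountably many, so the coins
    live on a product of uncountably many copies of {0, 1}, whose measure is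
    obtained by extending the obvious mass of cylinders. And [X] may be
    unbounded, so there is no coarsest level to start from; the coin of a
    component is therefore compared with that of the component of a base
    point, which makes all sufficiently coarse exchanges trivial. *)

(** * Uncountably many fair coins *)

Section CoordinateAverages.
Context {R : realType} {A : choiceType}.
Implicit Types (w : A -> bool) (g h : (A -> bool) -> R) (l : seq A).

Definition set_coord w a b : A -> bool := fun x => if x == a then b else w x.

Definition depends_on (D : pred A) (T : Type) (g : (A -> bool) -> T) :=
  forall w w', (forall x, D x -> w x = w' x) -> g w = g w'.

Definition avg1 a g : (A -> bool) -> R :=
  fun w => (g (set_coord w a true) + g (set_coord w a false)) / 2.

(** The expectation over the coordinates in [l] only. It is kept as an operator
    on functions of all coordinates, so that averages over different lists can
    be compared. *)
Definition avg l g := foldr avg1 g l.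

Lemma avg1C a b g : avg1 a (avg1 b g) = avg1 b (avg1 a g).
Proof.
have [->//|ab] := eqVneq a b.
have E w c c' : set_coord (set_coord w a c) b c' = set_coord (set_coord w b c') a c.
  apply/funext => x; rewrite /set_coord.
  by case: eqP => [->|//]; rewrite eq_sym (negbTE ab).
by apply/funext => w; rewrite /avg1 !E; ring.
Qed.

Lemma avg_avg1C l a g : avg l (avg1 a g) = avg1 a (avg l g).
Proof. by elim: l => //= b l ->; rewrite avg1C. Qed.

Lemma avgC l l' g : avg l (avg l' g) = avg l' (avg l g).
Proof. by elim: l' => //= b l' IH; rewrite avg_avg1C IH. Qed.

Lemma avg_cst l (c : R) : avg l (cst c) = cst c.
Proof. by elim: l => //= a l ->; apply/funext => w; rewrite /avg1 /cst; lra. Qed.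

Lemma avgD l g h : avg l (fun w => g w + h w) = (fun w => avg l g w + avg l h w).
Proof.
by elim: l => //= a l ->; apply/funext => w; rewrite /avg1; ring.
Qed.

Lemma le_avg l g h : (forall w, g w <= h w) -> forall w, avg l g w <= avg l h w.
Proof.
move=> gh; elim: l => //= a l IH w; rewrite /avg1 ler_pM2r ?invr_gt0//.
exact: lerD.
Qed.

Lemma depends_avg l (D : pred A) g : depends_on D g ->
  depends_on (fun x => D x && (x \notin l)) (avg l g).
Proof.
move=> Dg; elim: l => /= [|a l IH] w w' ww'.
  by apply: Dg => x Dx; apply: ww'; rewrite Dx.
have E b : avg l g (set_coord w a b) = avg l g (set_coord w' a b).
  apply: IH => x /andP[Dx xl]; rewrite /set_coord; case: eqP => // /eqP xa.
  by apply: ww'; rewrite Dx inE negb_or xa.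
by rewrite /avg1 !E.
Qed.

Lemma avg_depends l g w : depends_on (mem l) g -> avg l g = cst (avg l g w).
Proof.
move=> lg; have := @depends_avg l _ _ lg.
move=> {}lg; apply/funext => w'; apply: lg => x /=.
by rewrite andbN.
Qed.

(** Either average of [g] is already constant, hence fixed by the other one, and
    the two averages commute. This makes the mass of a cylinder independent of
    the coordinates used to compute it. *)
Lemma eq_avg_depends l l' g : depends_on (mem l) g -> depends_on (mem l') g ->
  avg l g = avg l' g.
Proof.
move=> /(avg_depends xpred0) lg /(avg_depends xpred0) lg'.
have := avgC l l' g.
by rewrite lg lg' !avg_cst.
Qed.

End CoordinateAverages.

(** An alias of the function type, to carry the algebra of cylinders next to the
    product topology. *)
Definition coins (A : choiceType) : Type := {ptws A -> bool}.

Section CoinSpace.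
Context (A : choiceType).
Implicit Types (l : seq A).

HB.instance Definition _ := Pointed.on (coins A).
HB.instance Definition _ := Topological.on (coins A).

Definition cylinder (E : set (coins A)) :=
  exists l : seq A, depends_on (mem l) E.

Lemma depends_onS (D D' : pred A) (T : Type) (g : (A -> bool) -> T) :
  (forall x, D x -> D' x) -> depends_on D g -> depends_on D' g.
Proof. by move=> DD' Dg w w' ww'; apply: Dg => x /DD' /ww'. Qed.

Lemma depends_catl l l' (T : Type) (g : (A -> bool) -> T) :
  depends_on (mem l) g -> depends_on (mem (l ++ l')) g.
Proof. by apply: depends_onS => x /=; rewrite mem_cat => ->. Qed.

Lemma depends_catr l l' (T : Type) (g : (A -> bool) -> T) :
  depends_on (mem l') g -> depends_on (mem (l ++ l')) g.
Proof. by apply: depends_onS => x /=; rewrite mem_cat => ->; rewrite orbT. Qed.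

Lemma cylinder0 : cylinder set0.
Proof. by exists [::]. Qed.

Lemma cylinderC E : cylinder E -> cylinder (~` E).
Proof. by move=> [l lE]; exists l => w w' /lE; rewrite /setC /mkset => ->. Qed.

Lemma cylinderU E F : cylinder E -> cylinder F -> cylinder (E `|` F).
Proof.
move=> [l lE] [l' lF]; exists (l ++ l') => w w' ww'; rewrite /setU /mkset.
by rewrite (depends_catl lE ww') (depends_catr lF ww').
Qed.

HB.instance Definition _ := @isAlgebraOfSets.Build default_measure_display
  (coins A) cylinder cylinder0 cylinderU cylinderC.

(** With [cylinderC], cylinders are compact as well, so that a countable cover
    of a cylinder by cylinders has a finite subcover. *)
Lemma open_cylinder (E : set (coins A)) : cylinder E -> open E.
Proof.
move=> [l lE]; rewrite openE => w Ew.
suff : nbhs (w : coins A) [set w' | forall x, x \in l -> w x = w' x].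
  by apply: filterS => w' /lE <-.
elim: l {lE} => [|a l IH]; first by apply: filterS filterT.
have Na : nbhs (w : coins A) [set w' | w a = w' a].
  have := @proj_continuous A (fun=> bool) a w.
  apply; rewrite /= nbhs_principalE /principal_filter/=.
  by move=> x ->.
apply: filterS2 Na IH => w' wa wl x; rewrite inE => /orP[/eqP->//|].
exact: wl.
Qed.

Context {R : realType}.

(** The list of coordinates is chosen arbitrarily, which is harmless by
    [eq_avg_depends]. *)
Definition coin_mass (E : set (coins A)) : R :=
  avg (xget [::] (fun l : seq A => depends_on (mem l) E)) \1_E xpred0.

Lemma depends_indic l (E : set (coins A)) :
  depends_on (mem l) E -> depends_on (mem l) (\1_E : _ -> R).
Proof.
move=> lE w w' /lE EE; rewrite !indicE; congr (nat_of_bool _)%:R.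
by apply/idP/idP => /set_mem Ew; apply/mem_set; [rewrite -EE|rewrite EE].
Qed.

Lemma coin_massE l E w : depends_on (mem l) E -> coin_mass E = avg l \1_E w.
Proof.
move=> lE; rewrite /coin_mass; case: xgetP => [l' _ l'E|/(_ l)//].
rewrite (eq_avg_depends (depends_indic l'E) (depends_indic lE)).
by rewrite (avg_depends xpred0 (depends_indic lE)).
Qed.

Lemma coin_mass_ge0 E : 0 <= coin_mass E.
Proof.
rewrite /coin_mass; set l := xget _ _.
rewrite -[leLHS](congr1 (fun h => h xpred0) (avg_cst l 0)).
by apply: le_avg => w; rewrite indicE.
Qed.

Lemma coin_massU (E F : set (coins A)) : cylinder E -> cylinder F ->
  E `&` F = set0 -> coin_mass (E `|` F) = coin_mass E + coin_mass F.
Proof.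
move=> [l lE] [l' lF] EF.
have [lE' lF'] := (@depends_catl l l' _ _ lE, @depends_catr l l' _ _ lF).
have lEF : depends_on (mem (l ++ l')) (E `|` F).
  by move=> w w' ww'; rewrite /setU /mkset (lE' _ _ ww') (lF' _ _ ww').
rewrite (coin_massE xpred0 lE') (coin_massE xpred0 lF') (coin_massE xpred0 lEF).
rewrite -[RHS](congr1 (fun h => h xpred0) (avgD _ _ _)); congr (avg _ _ _).
apply/funext => w; rewrite !indicE in_setU.
have : (w \in E) && (w \in F) = false by rewrite -in_setI EF in_set0.
by case: (w \in E) => /= [->|_]; rewrite ?addr0 ?add0r.
Qed.

Let mu (E : set (coins A)) : \bar R := (coin_mass E)%:E.

Let mu_ge0 E : (0 <= mu E)%E. Proof. by rewrite lee_fin coin_mass_ge0. Qed.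

Let mu0 : mu set0 = 0%E.
Proof. by rewrite /mu (@coin_massE [::] _ xpred0)//= indic0. Qed.

Let mu_semi_additive : measure_function.semi_additive mu.
Proof.
apply/(additive2P mu0) => E F cE cF EF.
by rewrite /mu (coin_massU cE cF EF) EFinD.
Qed.

#[local] HB.instance Definition _ := isContent.Build default_measure_display
  (coins A) R mu mu_ge0 mu_semi_additive.

Let compact_coins : compact [set: coins A].
Proof.
have := @tychonoff A (fun=> bool) (fun=> setT) (fun=> bool_compact).
by congr (compact _); apply/seteqP; split.
Qed.

(** By compactness, countable subadditivity on cylinders is finite
    subadditivity. *)
Let mu_sigma_subadditive : measurable_subset_sigma_subadditive mu.
Proof.
move=> E F cF cE EF.
have cptE : compact (E : set (coins A)).
  apply: subclosed_compact compact_coins _ => //.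
  by rewrite -openC; apply: open_cylinder; exact: cylinderC.
have : cover_compact (E : set (coins A)) by rewrite -compact_cover.
move=> /(_ nat setT F) [n _||D _ EFD]; [exact: open_cylinder (cF n)|exact: EF|].
rewrite (le_trans (@content_sub_fsum _ _ _ mu _ [set` D] E F _ _ _ _))//.
rewrite nneseries_esum//.
by rewrite esum_ge//; exists [set` D].
Qed.

#[local] HB.instance Definition _ := Content_SigmaSubAdditive_isMeasure.Build
  default_measure_display R (coins A) mu mu_sigma_subadditive.

Definition coin_measure := measure_extension mu.

#[local] HB.instance Definition _ := Measure.on coin_measure.

Let coin_measureE E : cylinder E -> coin_measure E = (coin_mass E)%:E.
Proof. by move=> cE; rewrite /coin_measure/measure_extension/= measurable_mu_extE. Qed.

Let coin_measureT : coin_measure setT = 1%E.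
Proof.
rewrite coin_measureE; last by rewrite -setC0; exact: cylinderC cylinder0.
by rewrite (@coin_massE [::] _ xpred0)//= indicT.
Qed.

#[local] HB.instance Definition _ :=
  Measure_isProbability.Build _ _ _ coin_measure coin_measureT.

Lemma exists_coin_measure : exists P : probability
    (g_sigma_algebraType (@measurable _ (coins A))) R,
  forall E, cylinder E -> P E = (coin_mass E)%:E.
Proof. by exists coin_measure; exact: coin_measureE. Qed.

End CoinSpace.

(** Only two coins are ever compared at a time, so pairwise independence, in the
    form that two coins differ with probability one half, is all that is kept of
    the product measure. *)
Lemma exists_fair_coins (R : realType) (A : choiceType) :
  exists (d : measure_display) (Om : measurableType d) (P : probability Om R)
    (coin : A -> Om -> bool),
  (forall a, measurable_fun setT (coin a)) /\
  (forall a b, a != b -> P [set w | coin a w != coin b w] = (2^-1)%:E).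
Proof.
have [P PE] := @exists_coin_measure A R.
exists _, _, P, (fun a w => w a); split.
  move=> a; apply: (@measurable_fun_bool _ _ _ _ true).
  rewrite setTI; apply: sub_sigma_algebra; exists [:: a] => w w' ww'.
  by rewrite /preimage /mkset ww'//= inE.
move=> a b ab; have lE : depends_on (mem [:: a; b])
    ([set w | w a != w b] : set (coins A)).
  by move=> w w' ww'; rewrite /mkset !ww'// /= !inE eqxx ?orbT.
rewrite PE; last by exists [:: a; b].
have inE' (w : coins A) : (w \in [set w | w a != w b]) = (w a != w b).
  by apply/idP/idP; rewrite inE.
rewrite (coin_massE xpred0 lE)/= /avg1/= !indicE /set_coord !inE'.
rewrite !eqxx (negbTE ab)/=; congr (_%:E); lra.
Qed.

(** * Shifted dyadic grids *)

Lemma int_up_ind (P : int -> Prop) (m : int) : P m ->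
  (forall j, m <= j -> P j -> P (j + 1)) -> forall j, m <= j -> P j.
Proof.
move=> Pm PS j mj; have -> : j = m + `|j - m|%N by lia.
elim: `|j - m|%N => [|n IH]; first by rewrite addr0.
by have -> : m + n.+1 = m + n + 1 :> int; [lia|apply: PS => //; lia].
Qed.

Section DyadicPowers.
Context {R : realType}.
Implicit Types (j k : int).

Lemma pow2_gt0 j : 0 < 2 ^ j :> R. Proof. exact: exprz_gt0. Qed.

Lemma pow2S j : 2 ^ (j + 1) = 2 * 2 ^ j :> R.
Proof. by rewrite expfzDr// expr1z mulrC. Qed.

Lemma pow2N j : 2 ^ (- j) = (2 ^ j)^-1 :> R.
Proof. by rewrite invr_expz. Qed.

Lemma le_pow2 j k : j <= k -> 2 ^ j <= 2 ^ k :> R.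
Proof. by move=> jk; rewrite ler_weXz2l// ler1n. Qed.

Lemma le_pow2N j k : j <= k -> 2 ^ (- k) <= 2 ^ (- j) :> R.
Proof. by move=> jk; rewrite le_pow2// lerN2. Qed.

Lemma pow2_unbounded (a : R) : exists k, a <= 2 ^ k.
Proof.
have [n an] : exists n : nat, a <= n%:R.
  by exists (Num.bound `|a|); rewrite (le_trans (ler_norm _))// ltW// archi_boundP.
exists n; rewrite (le_trans an)// -exprnP -natrX ler_nat ltnW//.
exact: ltn_expl.
Qed.

Lemma small_pow2 (a : R) : 0 < a -> exists k, forall j, j <= k -> 2 ^ j <= a.
Proof.
move=> a0; have [k ak] := pow2_unbounded a^-1.
exists (- k) => j /le_pow2 /le_trans; apply; rewrite pow2N -(invrK a).
by rewrite lef_pV2// posrE ?invr_gt0// pow2_gt0.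
Qed.

Lemma dyadic_scale (a : R) : 0 < a -> exists k, 2 ^ (- k) < a <= 2 * 2 ^ (- k).
Proof.
move=> a0; apply: contrapT => N.
have [m mP] : exists m, forall j, j <= m -> 2 ^ j <= a / 2.
  by apply: small_pow2; rewrite divr_gt0.
have lt_a : forall j, m <= j -> 2 ^ j < a :> R.
  apply: int_up_ind => [|j _ ja]; first by have := mP m (lexx _); lra.
  rewrite ltNge; apply/negP => aj; apply: N; exists (- j).
  by rewrite opprK ja -pow2S.
have [k ak] := pow2_unbounded a.
have := lt_a (Num.max m k); rewrite le_max lexx => /(_ isT).
by rewrite ltNge (le_trans ak)// le_pow2// le_max lexx orbT.
Qed.

End DyadicPowers.

Section Grid.
Context {R : realType} (e : int).
Implicit Types (j k p : int) (s t : R).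

(** The cells of level [j] have side [2 ^ - j] and their end points are the
    integers plus [offset j], times that side. Since twice one third is one
    minus one third, the alternating sign makes the grids nested (see
    [cell_succ]). The end points stay at distance [2 ^ - j / 3] from 0, so that
    any two reals share all coarse cells. Changing the parity of [e] moves the
    end points to the other thirds. *)
Definition offset j : R := (-1) ^ (j + e) / 3.
Definition pos j t : R := 2 ^ j * t - offset j.
Definition cell j t : int := Num.floor (pos j t).
(** The position inside the cell, as a fraction of its side. *)
Definition rel_pos j t : R := pos j t - (cell j t)%:~R.
Definition digit j t : bool := 2^-1 <= rel_pos j t.

Lemma sign_expz (n : int) : (-1) ^ n = 1 :> R \/ (-1) ^ n = -1 :> R.
Proof.
case: n => n; rewrite ?NegzE -?invr_expz -exprnP -signr_odd;
by case: (odd _); rewrite ?expr1 ?expr0 ?invrN ?invr1; [right|left].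
Qed.

Lemma offsetS j : offset (j + 1) = - offset j.
Proof. by rewrite /offset addrAC expfzDr ?oppr_eq0// expr1z; lra. Qed.

Lemma rel_pos_itv j t : 0 <= rel_pos j t < 1.
Proof.
by have := floor_itv (pos j t); rewrite /rel_pos /cell intrD => /andP[? ?]; lra.
Qed.

Lemma cellP j t (n : int) (r : R) : 0 <= r < 1 -> pos j t = n%:~R + r ->
  cell j t = n /\ rel_pos j t = r.
Proof.
move=> r01 E; have En : cell j t = n.
  by apply: floor_def; rewrite E intrD; lra.
by split=> //; rewrite /rel_pos En E; ring.
Qed.

Lemma pos_split j t : pos j t = (cell j t)%:~R + rel_pos j t.
Proof. by rewrite /rel_pos; ring. Qed.

Lemma cell_succ j : exists k : int, forall t,
  cell (j + 1) t = 2 * cell j t + k + (digit j t : nat)%:Z /\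
  rel_pos (j + 1) t = 2 * rel_pos j t - (digit j t)%:R.
Proof.
have [k kE] : exists k : int, 3 * offset j = k%:~R.
  by rewrite /offset; case: (sign_expz (j + e)) => ->; [exists 1|exists (-1)];
    rewrite ?intrN /=; lra.
exists k => t; apply: cellP; have := rel_pos_itv j t; rewrite /digit.
  by case: (leP 2^-1 (rel_pos j t)) => /= ? ?; lra.
rewrite !intrD intrM -kE {1}/pos pow2S offsetS.
have := pos_split j t; rewrite /pos => E _.
rewrite (_ : 2 * _ * t = 2 * (2 ^ j * t - offset j) + 2 * offset j); last by ring.
rewrite E; case: (_ <= _) => /=; ring.
Qed.

Lemma cellS_eq j s t : cell (j + 1) s = cell (j + 1) t <->
  cell j s = cell j t /\ digit j s = digit j t.
Proof.
have [k kE] := cell_succ j; rewrite (kE s).1 (kE t).1.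
split=> [|[-> ->]//].
by case: (digit j s) (digit j t) => -[] /= ?; split=> //; lia.
Qed.

(** As [j] tends to minus infinity, [pos j s] tends to the offset, which is
    1/3 or -1/3 and in either case is far from the integers. *)
Lemma cell_common s t : exists m, forall j, j <= m -> cell j s = cell j t.
Proof.
have N0 : 0 < `|s| + `|t| + 1 by have := normr_ge0 s; have := normr_ge0 t; lra.
have /small_pow2[m mP] : 0 < (`|s| + `|t| + 1)^-1 / 4 by rewrite divr_gt0 ?invr_gt0.
exists m => j /mP jm.
have small x : `|x| <= `|s| + `|t| -> `|2 ^ j * x| <= 4^-1.
  move=> xst; rewrite normrM (gtr0_norm (pow2_gt0 _)).
  apply: (@le_trans _ _ ((`|s| + `|t| + 1)^-1 / 4 * `|x|)).
    by rewrite ler_wpM2r.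
  rewrite mulrAC ler_pdivrMr// mulVf// ?ler_pdivrMl// ?mulr1 //; lra.
have [hs ht] : `|2 ^ j * s| <= 4^-1 /\ `|2 ^ j * t| <= 4^-1.
  by split; apply: small; rewrite ?lerDl ?lerDr.
move: hs ht; rewrite !ler_norml => /andP[S1 S2] /andP[T1 T2].
have [sg|sg] := sign_expz (j + e).
- by transitivity (-1 : int); [|symmetry]; apply: floor_def;
    rewrite /pos /offset sg /= ?intrN; lra.
- by transitivity (0 : int); [|symmetry]; apply: floor_def;
    rewrite /pos /offset sg /= ?intrN; lra.
Qed.

Lemma cell_down j k s t : j <= k -> cell k s = cell k t -> cell j s = cell j t.
Proof.
move: k; apply: int_up_ind => // k jk IH /cellS_eq[] /IH //.
Qed.

(** The digits form a two-sided sequence, and all the digits below [k] do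
    determine the cell of level [k] because there is nothing to distinguish at
    coarse levels. *)
Lemma digits_cell k s t :
  (forall j, j < k -> digit j s = digit j t) <-> cell k s = cell k t.
Proof.
split=> [D|E j jk]; last first.
  by apply: (iffLR (cellS_eq j s t) _).2; apply: cell_down E; lia.
have [m mP] := cell_common s t.
have [km|mk] := leP k m; first exact: mP.
move: k {mk} (ltW mk) D; apply: int_up_ind => [_|k mk IH D]; first exact: mP.
by apply/cellS_eq; split; [apply: IH => j jk|]; apply: D; lia.
Qed.

Lemma digit_flip k t : exists t', cell k t' = cell k t /\ digit k t' = ~~ digit k t.
Proof.
pose h : R := if digit k t then - 2^-1 else 2^-1.
exists (t + 2 ^ (- k) * h).
have /cellP[] : pos k (t + 2 ^ (- k) * h) = (cell k t)%:~R + (rel_pos k t + h).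
- rewrite addrA -pos_split /pos mulrDr mulrA pow2N mulfV ?gt_eqF ?pow2_gt0//; ring.
- by move: (rel_pos_itv k t); rewrite /h /digit; case: (leP 2^-1 (rel_pos k t)) => ? /= ?; lra.
move=> -> rE; split=> //; rewrite {1}/digit rE.
move: (rel_pos_itv k t); rewrite /h /digit; case: (leP 2^-1 (rel_pos k t)) => ? ? /=; apply/idP; lra.
Qed.

(** Modifying digits from level [m] onwards permutes the cells of each level;
    in particular prescribing such digits selects a set of the same measure. *)
Lemma cells_of_digits (a : int -> bool) t0 m k :
  (forall j, j < m -> a j = digit j t0) ->
  exists t, forall s, (forall j, j < k -> digit j s = a j) <-> cell k s = cell k t.
Proof.
move=> am; have [km|mk] := leP k m.
  exists t0 => s; rewrite -digits_cell.
  by split=> D j jk; rewrite D// am//; lia.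
move: k {mk} (ltW mk); apply: int_up_ind => [|k mk [t tE]].
  exists t0 => s; rewrite -digits_cell.
  by split=> D j jk; rewrite D// am//; lia.
have [t' [t't at']] : exists t', cell k t' = cell k t /\ digit k t' = a k.
  have [|ne] := eqVneq (digit k t) (a k); first by exists t.
  have [t' [? E]] := digit_flip k t; exists t'; split=> //.
  by rewrite E; case: (digit k t) (a k) ne => -[].
exists t' => s; rewrite cellS_eq t't at' -tE; split=> [D|[D ?] j jk].
  by split=> [j jk|]; apply: D; lia.
by have [->//|?] := eqVneq j k; apply: D; lia.
Qed.

Section Adjacent.
Variables (s t : R) (k : int).
Hypotheses (st : s <= t) (ts : t - s <= 2 ^ (- k)).

Lemma cell_adjacent j : j <= k -> cell j t = cell j s \/ cell j t = cell j s + 1.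
Proof.
move=> jk.
have le1 : 2 ^ j * (t - s) <= 1.
  apply: (@le_trans _ _ (2 ^ k * 2 ^ (- k))); last first.
    by rewrite pow2N mulfV// gt_eqF ?pow2_gt0.
  by rewrite ler_pM// ?subr_ge0// ?le_pow2// ltW ?pow2_gt0.
have ge0 : 0 <= 2 ^ j * (t - s) by rewrite mulr_ge0 ?subr_ge0// ltW ?pow2_gt0.
have Et : pos j t = pos j s + 2 ^ j * (t - s) by rewrite /pos; ring.
have : cell j s <= cell j t by apply: le_floor; lra.
have : cell j t < cell j s + 2.
  rewrite -(ltr_int R) intrD; have := pos_split j s; have := pos_split j t.
  by have := rel_pos_itv j s; have := rel_pos_itv j t; lra.
by lia.
Qed.

(** Two close points [s <= t] whose cells part do so at a common end point of
    adjacent cells. From then on the digits of [s] are 0111... and those of [t]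
    are 1000..., as long as the cells are not smaller than the gap. *)
Lemma digit_split j : j < k -> cell j s = cell j t -> digit j s != digit j t ->
  digit j s = false /\ digit j t = true.
Proof.
move=> jk E D; have [c cE] := cell_succ j.
have jk' : j + 1 <= k by lia.
have [|] := cell_adjacent jk'; rewrite (cE s).1 (cE t).1 E;
  by move: D; case: (digit j s) (digit j t) => -[] //= _; lia.
Qed.

Lemma digit_after_split j : j < k -> cell j s != cell j t ->
  digit j s = true /\ digit j t = false.
Proof.
move=> jk D; have [c cE] := cell_succ j.
have jk' : j + 1 <= k by lia.
have [E|E] := cell_adjacent (ltW jk); first by rewrite E eqxx in D.
have [|] := cell_adjacent jk'; rewrite (cE s).1 (cE t).1 E;
  by case: (digit j s) (digit j t) => -[] //=; lia.
Qed.

End Adjacent.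

Lemma first_split p s t : cell p s != cell p t ->
  exists2 i, i < p & cell i s = cell i t /\ digit i s != digit i t.
Proof.
have [m mP] := cell_common s t.
have [pm|mp] := leP p m; first by rewrite mP ?eqxx.
move: p {mp} (ltW mp); apply: int_up_ind => [|p mp IH D]; first by rewrite mP ?eqxx.
have [E|/IH[i ip ?]] := eqVneq (cell p s) (cell p t); last by exists i; first lia.
exists p; [lia|split=> //]; apply: contraNneq D => D.
exact/eqP/cellS_eq.
Qed.

(** Four equal digits in a row place [t] within 1/16 of an end of its cell. *)
Lemma digit_ne k t b : 12^-1 <= rel_pos k t <= 11 / 12 ->
  exists2 l, k <= l <= k + 3 & digit l t != b.
Proof.
move=> kt; apply: contrapT => D.
have dE l : k <= l -> l <= k + 3 -> digit l t = b.
  move=> kl lk; apply: contrapT => /eqP lb.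
  by apply: D; exists l => //; rewrite kl.
have rE l : digit l t = b -> if b then 2^-1 <= rel_pos l t else rel_pos l t < 2^-1.
  by rewrite /digit => <-; case: leP.
have d0 := dE k ltac:(lia) ltac:(lia); have d1 := dE (k + 1) ltac:(lia) ltac:(lia).
have d2 := dE (k + 1 + 1) ltac:(lia) ltac:(lia).
have d3 := dE (k + 1 + 1 + 1) ltac:(lia) ltac:(lia).
have [_ /(_ t)[_]] := cell_succ k; have [_ /(_ t)[_]] := cell_succ (k + 1).
have [_ /(_ t)[_]] := cell_succ (k + 1 + 1).
have := rel_pos_itv (k + 1 + 1 + 1) t.
move: (rE _ d0) (rE _ d1) (rE _ d2) (rE _ d3); rewrite d0 d1 d2.
by case: b {D dE rE d0 d1 d2 d3} => /= ? ? ? ? ? E2 E1 E0; lra.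
Qed.

Lemma cell_itv k n : [set s | cell k s = n] =
  `[2 ^ (- k) * (n%:~R + offset k), 2 ^ (- k) * (n%:~R + offset k + 1)[%classic.
Proof.
apply/seteqP; split=> s /=; rewrite in_itv/= pow2N ler_pdivrMl ?pow2_gt0//.
  rewrite ltr_pdivlMl ?pow2_gt0// => sn; have := floor_itv (pos k s).
  rewrite -/(cell k s) sn /pos intrD => /andP[? ?]; apply/andP; split; lra.
rewrite ltr_pdivlMl ?pow2_gt0// => /andP[? ?]; apply: floor_def.
by rewrite /pos intrD; lra.
Qed.

Lemma measurable_cell k n : measurable [set s : measurableTypeR R | cell k s = n].
Proof. by rewrite cell_itv; exact: measurable_itv. Qed.

Lemma lebesgue_cell k n :
  lebesgue_measure [set s : measurableTypeR R | cell k s = n] = (2 ^ (- k))%:E.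
Proof.
rewrite cell_itv lebesgue_measure_itv/= lte_fin ltr_pM2l ?pow2_gt0// ltrDl ltr01.
by rewrite -EFinD; congr (_%:E); ring.
Qed.

End Grid.

(** In units of the side, the end points of the two grids are at distance at
    least 1/3 from each other, so one of the grids has none within 1/6 of [t]. *)
Lemma well_placed_grid {R : realType} (s t : R) (k : int) :
  2 ^ k * `|s - t| <= 12^-1 -> exists2 e : int, e = 0 \/ e = 1 &
  cell e k s = cell e k t /\ 12^-1 <= rel_pos e k t <= 11 / 12.
Proof.
move=> st.
pose y : R := 2 ^ k * (s - t).
have /andP[y1 y2] : - 12^-1 <= y <= 12^-1.
  by rewrite -ler_norml normrM (gtr0_norm (pow2_gt0 _)).
have posE e : pos e k s = pos e k t + y by rewrite /pos /y; ring.
have ok e n r : 6^-1 <= r <= 5 / 6 -> pos e k t = n%:~R + r ->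
    cell e k s = cell e k t /\ 12^-1 <= rel_pos e k t <= 11 / 12.
  move=> r16 E.
  have [-> ->] : cell e k t = n /\ rel_pos e k t = r by apply: cellP E; lra.
  have [-> _] : cell e k s = n /\ rel_pos e k s = r + y.
    by apply: cellP; [lra|rewrite posE E addrA].
  by split=> //; lra.
have pos1 : pos 1 k t = pos 0 k t + 2 / 3 * (-1) ^ k.
  by rewrite /pos /offset addr0 expfzDr ?oppr_eq0// expr1z; ring.
have := rel_pos_itv 0 k t; have := pos_split 0 k t.
set n := cell 0 k t; set r := rel_pos 0 k t => posn /andP[r0 r1].
have [r6|r6] := ltP r 6^-1.
  exists 1; first by right.
  have [sg|sg] := @sign_expz R k; rewrite sg in pos1.
    by apply: (ok _ n (r + 2 / 3)); lra.
  by apply: (ok _ (n - 1) (r + 1 / 3)); rewrite ?intrD ?intrN; lra.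
have [r5|r5] := leP r (5 / 6); first by exists 0; [left|apply: ok posn; lra].
exists 1; first by right.
have [sg|sg] := @sign_expz R k; rewrite sg in pos1.
  by apply: (ok _ (n + 1) (r - 1 / 3)); rewrite ?intrD; lra.
by apply: (ok _ n (r - 2 / 3)); lra.
Qed.

(** * Cutting along the tree of components *)

Section CutAlongTree.
Context {R : realType} {X : metricType R} (u : X -> R) (x0 : X) (e : int).
Implicit Types (j k l p : int) (x y z : X) (s t : R).

Local Notation cell := (cell e).
Local Notation digit := (digit e).

(** Requiring consecutive points of the chain to share their cell keeps the whole
    chain in the slab over that cell. *)
Definition joined j x y : Prop :=
  exists2 l : seq X,
    path (fun a b => (mdist a b <= 2 ^ (- j)) && (cell j (u a) == cell j (u b))) x l
    & last x l = y.

Lemma joined_refl j x : joined j x x.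
Proof. by exists [::]. Qed.

Lemma joined_trans j y x z : joined j x y -> joined j y z -> joined j x z.
Proof.
move=> [l lP <-] [l' lP' <-]; exists (l ++ l'); last by rewrite last_cat.
by rewrite cat_path lP.
Qed.

Lemma joined1 j x y : mdist x y <= 2 ^ (- j) -> cell j (u x) = cell j (u y) ->
  joined j x y.
Proof. by move=> xy E; exists [:: y] => //=; rewrite xy E eqxx. Qed.

Lemma joined_sym j x y : joined j x y -> joined j y x.
Proof.
move=> [l + <-]; elim: l x => [|a l IH] x /=; first by move=> _; exact: joined_refl.
move=> /andP[/andP[xa /eqP E]] /IH /joined_trans; apply.
by apply: joined1; rewrite // metric_sym.
Qed.

Lemma joined_down j k x y : j <= k -> joined k x y -> joined j x y.
Proof.
move=> jk [l lP <-]; exists l => //; apply: sub_path lP => a b /andP[ab /eqP E].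
by rewrite (le_trans ab) ?le_pow2N//= (cell_down jk E).
Qed.

Lemma joined_common x y : exists m, forall j, j <= m -> joined j x y.
Proof.
have [m mP] := cell_common e (u x) (u y); have [k xyk] := pow2_unbounded (mdist x y).
exists (Num.min m (- k)) => j; rewrite le_min => /andP[jm jk].
by apply: joined1; [rewrite (le_trans xyk)// le_pow2; lia|exact: mP].
Qed.

Definition label j x : set X := [set y | joined j x y].

Lemma label_joined j x y : joined j x y -> label j x = label j y.
Proof.
move=> xy; apply/seteqP; split=> z; last exact: joined_trans.
by apply: joined_trans; exact: joined_sym.
Qed.

Lemma joined_label j x y : label j x = label j y -> joined j x y.
Proof. by move=> xy; suff : label j x y by []; rewrite xy; exact: joined_refl. Qed.

Section FixedCoins.
Variable c : set X -> bool.

(** Whether the component of [x] exchanges the halves of its cell. Comparing with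
    the component of the base point makes this false at all coarse levels, where
    [x] and [x0] are joined; this replaces starting from a coarsest level. *)
Definition flip j x := c (label j x) (+) c (label j x0).
(** The digits of the thresholds that never decide [x]. *)
Definition code j x := digit j (u x) (+) flip j x.
(** The thresholds that have not decided [x] before level [k], those that decide
    it at level [j], and those that [x] is above. *)
Definition active k x : set R := [set s | forall j, j < k -> digit j s = code j x].
Definition exits j x : set R := [set s | active j x s /\ digit j s != code j x].
Definition above x : set R := [set s | exists2 j, exits j x s & digit j (u x)].

Lemma code_common x : exists m, forall j, j < m -> code j x = digit j (u x).
Proof.
have [m mP] := joined_common x x0; exists m => j jm.
by rewrite /code /flip (label_joined (mP j _)) ?addbb ?addbF//; lia.
Qed.

(** The code of [x] is a modification of the digits of [u x] from some level
    onwards. *)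
Lemma active_cell k x : exists t, active k x = [set s | cell k s = cell k t].
Proof.
have [m mP] := code_common x; have [t tE] := cells_of_digits k mP.
by exists t; apply/seteqP; split=> s /tE.
Qed.

(** Being decided at level [k] is following the code of [x] with its digit at [k]
    inverted. *)
Lemma exits_cell k x : exists t, exits k x = [set s | cell (k + 1) s = cell (k + 1) t].
Proof.
have [m mP] := code_common x.
pose a j := if j == k then ~~ code k x else code j x.
have am j : j < Num.min m k -> a j = digit j (u x).
  by rewrite lt_min /a => /andP[jm jk]; rewrite lt_eqF// mP.
have [t tE] := cells_of_digits (k + 1) am; exists t; apply/seteqP; split=> s.
  move=> [sx sk]; apply/tE => j jk; rewrite /a; case: eqP => [->|/eqP ne].
    by move: sk; case: (digit k s) (code k x) => -[].
  by apply: sx; lia.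
move=> /tE D; split=> [j jk|].
  by have := D j; rewrite /a lt_eqF// => ->//; lia.
by have := D k; rewrite /a eqxx => ->; [case: (code _ _)|lia].
Qed.

Lemma exits_inj i j x s : exits i x s -> exits j x s -> i = j.
Proof.
move=> [si /eqP di] [sj /eqP dj]; case: (ltgtP i j) => // ij.
  by have := di (sj i ij).
by have := dj (si j ij).
Qed.

(** A first level of disagreement exists, since the threshold and the code of [x]
    agree at all coarse levels. *)
Lemma active_or_exits k x s : active k x s \/ exists2 p, p < k & exits p x s.
Proof.
have [m0 m0P] := code_common x; have [m1 m1P] := cell_common e s (u x).
pose m := Num.min m0 m1.
have am : active m x s.
  move=> j jm; rewrite m0P; last by rewrite /m in jm; lia.
  by apply: (iffRL (digits_cell e m s (u x)) _ j jm); apply: m1P; rewrite /m; lia.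
have [km|mk] := leP k m; first by left=> j jk; apply: am; lia.
move: k {mk} (ltW mk); apply: int_up_ind => [|k mk]; first by left.
move=> [sk|[p pk sp]]; last by right; exists p => //; lia.
have [E|ne] := eqVneq (digit k s) (code k x); last by right; exists k => //; lia.
left=> j jk; have [->//|?] := eqVneq j k; apply: sk; lia.
Qed.

Lemma above_exits j x s : exits j x s -> above x s <-> digit j (u x).
Proof.
move=> xs; split=> [[i ys di]|dj]; last by exists j.
by rewrite (exits_inj xs ys).
Qed.

(** As long as the cells are equal, the coins are the same, and the two points
    follow the same code. At the level [i] where the digits part, the threshold
    decides exactly one point, the lower one negatively or the upper one
    positively; if the other point is decided before level [k], its digit there
    is the one that gives the same verdict, by [digit_after_split]. *)
Lemma exits_close x y k p q s : (`|u x - u y| <= mdist x y) ->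
    mdist x y <= 2 ^ (- k) -> u x <= u y ->
    p < k -> q < k -> exits p x s -> exits q y s -> digit p (u x) = digit q (u y).
Proof.
move=> uxy xyk xy pk qk [xs xp] [ys yq].
have yxk : u y - u x <= 2 ^ (- k).
  by apply: le_trans xyk; apply: le_trans uxy; rewrite distrC ler_norm.
have flipE j : j < k -> cell j (u x) = cell j (u y) -> flip j x = flip j y.
  move=> jk E; rewrite /flip (label_joined (joined1 _ E))//.
  by rewrite (le_trans xyk)// le_pow2N// ltW.
(* Equal coins and a common follower s force equal digits. *)
have no_split i : i < k -> i < p -> i < q -> cell i (u x) = cell i (u y) ->
    digit i (u x) = digit i (u y).
  move=> ik ip iq E; have := xs i ip; rewrite (ys i iq) /code flipE//.
  by case: (digit i (u x)) (digit i (u y)) (flip i y) => -[] [].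
have same i : i < k -> i <= p -> i <= q -> cell i (u x) = cell i (u y).
  move=> ik ip iq; apply/eqP/negPn/negP => /first_split[l li [E /eqP D]].
  by apply: D; apply: no_split => //; lia.
have agree i : i < k -> cell i (u x) = cell i (u y) -> digit i (u x) = digit i (u y) ->
    code i x = code i y.
  by move=> ik E D; rewrite /code flipE// D.
case: (ltgtP p q) => [pq|qp|E].
- have Ep := same p pk (lexx _) (ltW pq).
  have Dp : digit p (u x) != digit p (u y).
    by apply: contraNneq xp => D; rewrite (agree p pk Ep D) -ys.
  have [-> _] := digit_split xy yxk pk Ep Dp.
  have /(digit_after_split xy yxk qk)[_ -> //] : cell q (u x) != cell q (u y).
  apply: contra Dp => /eqP /(@cell_down _ e (p + 1)) E.
  by apply/eqP/(iffLR (cellS_eq e p _ _) _).2; apply: E; lia.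
- have Eq := same q qk (ltW qp) (lexx _).
  have Dq : digit q (u x) != digit q (u y).
    by apply: contraNneq yq => D; rewrite -(agree q qk Eq D) -xs.
  have [_ ->] := digit_split xy yxk qk Eq Dq.
  have /(digit_after_split xy yxk pk)[-> // _] : cell p (u x) != cell p (u y).
  apply: contra Dq => /eqP /(@cell_down _ e (q + 1)) E.
  by apply/eqP/(iffLR (cellS_eq e q _ _) _).2; apply: E; lia.
- subst q; have Ep := same p pk (lexx _) (lexx _).
  move: xp yq; rewrite /code flipE//.
  by case: (digit p s) (digit p (u x)) (digit p (u y)) (flip p y) => -[] [] [].
Qed.

(** A point is above or below a threshold according to its digit at the level
    where it is decided, so [exits_close] confines the thresholds separating [x]
    from [y] to two cells of level [k]. *)
Lemma above_close x y k s : (`|u x - u y| <= mdist x y) -> mdist x y <= 2 ^ (- k) ->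
  ~ active k x s -> ~ active k y s -> above x s <-> above y s.
Proof.
move=> uxy xyk nx ny.
have [//|[p pk xp]] := active_or_exits k x s.
have [//|[q qk yq]] := active_or_exits k y s.
rewrite (above_exits xp) (above_exits yq).
suff -> : digit p (u x) = digit q (u y) by [].
have [xy|/ltW yx] := leP (u x) (u y); first exact: exits_close xyk _ pk qk xp yq.
by apply/esym; apply: exits_close yx qk pk yq xp; rewrite 1?metric_sym// distrC.
Qed.

End FixedCoins.

Lemma first_separation x y k : ~ joined k x y -> exists2 j, j < k &
  joined j x y /\ ~ joined (j + 1) x y.
Proof.
have [m mP] := joined_common x y => nk; apply: contrapT => N; apply: nk.
have [km|mk] := leP k m; first exact: mP.
suff : forall j, m <= j -> j <= k -> joined j x y by apply; lia.
apply: int_up_ind => [_|j mj IH jk]; first exact: mP.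
by apply: contrapT => nj; apply: N; exists j; [lia|split=> //; apply: IH; lia].
Qed.

(** Let [j] be the first level where [x] and [y] are not joined. Down to [j] the
    same thresholds are active for both. If the coins at [j] differ, the codes at
    [j] agree exactly when the digits of [u x] and [u y] do not, which leaves two
    cases. In each of them a whole cell of thresholds gives opposite verdicts;
    that [u y] is away from the ends of its cell bounds its size from below. *)
Lemma separating_cell x y k : cell k (u x) = cell k (u y) ->
    12^-1 <= rel_pos e k (u y) <= 11 / 12 -> ~ joined k x y ->
  exists2 j, label j x <> label j y & forall c, c (label j x) != c (label j y) ->
  exists l t, l <= k + 3 /\ forall s, cell (l + 1) s = cell (l + 1) t ->
    ~ (above c x s <-> above c y s).
Proof.
move=> Ek yk /first_separation[i ik [xyi nxy]]; pose j := i + 1.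
exists j => [/joined_label //|c cxy].
have below p : p < j -> code c p x = code c p y.
  move=> pj; have xyp : joined p x y by apply: joined_down xyi; rewrite /j in pj; lia.
  rewrite /code /flip (label_joined xyp).
  suff -> : digit p (u x) = digit p (u y) by [].
  by apply: (iffRL (digits_cell e k _ _) Ek); move: pj ik; rewrite /j; lia.
have activeE s : active c j x s <-> active c j y s.
  by split=> xs l lj; rewrite xs// below.
have fxy : flip c j x != flip c j y.
  by move: cxy; rewrite /flip; case: (c (label j x)) (c (label j y)) (c (label j x0)) => -[] [].
have [Dj|Dj] := eqVneq (digit j (u x)) (digit j (u y)).
  (* The coins send x and y into different halves of the cell, and y is decided
     at a later level, with the opposite verdict. *)
  have [l /andP[kl lk] ly] := digit_ne (digit j (u x)) yk.
  have jl : j < l.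
    have [E|ne] := eqVneq j l; first by rewrite -E Dj eqxx in ly.
    by move: ne kl ik; rewrite /j; lia.
  have [t tE] := exits_cell c l y; exists l, t; split=> // s st.
  have ys : exits c l y s by rewrite tE.
  have xs : exits c j x s.
    split; first by apply/activeE => i' i'j; apply: ys.1; lia.
    rewrite (ys.1 j jl) /code -Dj.
    by move: fxy; case: (digit _ _) (flip c j x) (flip c j y) => -[] [].
  rewrite (above_exits xs) (above_exits ys).
  by move: ly; case: (digit l _) (digit j _) => -[] //= _ [? ?]; intuition.
(* The coins send x and y into the same half; a threshold in the other half
   decides both at once, with opposite verdicts. *)
have [t tE] := exits_cell c j y; exists j, t; split; first by rewrite /j; lia.
move=> s st; have ys : exits c j y s by rewrite tE.
have xs : exits c j x s.
  split; first exact/activeE/ys.1.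
  have := ys.2; rewrite /code; move: fxy Dj.
  by case: (digit j s) (digit j (u x)) (digit j (u y)) (flip c j x) (flip c j y)
    => -[] [] [] [].
rewrite (above_exits xs) (above_exits ys).
by move: Dj; case: (digit j _) (digit j _) => -[] //= _ [? ?]; intuition.
Qed.

End CutAlongTree.

(** * Cuts as elements of L1 *)

Section CutEmbedding.
Context d (Z : measurableType d) (R : realType) (mu : {measure set Z -> \bar R}).

Lemma exists_L1_class (g : Z -> R) : measurable_fun setT g ->
  (\int[mu]_z `|(g z)%:E| < +oo)%E -> exists F : L1 mu, L1_fun F = g %[ae mu].
Proof.
move=> mg g_fin.
pose gm := isMeasurableFun.Build _ _ Z (measurableTypeR R) g mg.
pose G : {mfun Z >-> measurableTypeR R} := HB.pack g gm.
pose c : {mfun_ mu, Z >-> measurableTypeR R} := (\pi G)%qT.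
have cG : repr c = G %[ae mu].
  have : (repr c == G %[mod {mfun_ mu, Z >-> measurableTypeR R}])%qT by rewrite reprK.
  by rewrite eqmodE => /asboolP.
have mnorm (h : {mfun Z >-> measurableTypeR R}) :
    measurable_fun setT (fun z => `|(h z : R)%:E|)%E.
  apply: measurableT_comp => //; apply/measurable_EFinP.
  exact: (@measurable_funPT _ _ _ _ h).
have c_fin : finite_norm mu 1 c.
  rewrite /finite_norm Lnorm1 (ae_eq_integral (fun z => `|(g z)%:E|)%E)//.
  - exact: mnorm (repr c).
  - exact: mnorm G.
  - by apply: filterS cG => z + _ => /(_ I) E; congr (`|_%:E|)%E.
pose cm := isFinLebesgue.Build _ _ _ mu _ (lexx 1%E) c c_fin.
pose F : LspaceType mu (lexx 1%E) := HB.pack c cm.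
by exists F.
Qed.

Lemma L1_dist_ae (F F' : L1 mu) (g g' : Z -> R) :
  measurable_fun setT g -> measurable_fun setT g' ->
  L1_fun F = g %[ae mu] -> L1_fun F' = g' %[ae mu] ->
  (mdist F F')%:E = (\int[mu]_z `|(g z - g' z)%:E|)%E.
Proof.
move=> mg mg' Fg Fg'; rewrite L1_mdistE; apply: ae_eq_integral => //.
- apply: measurableT_comp => //; apply/measurable_EFinP.
  exact: measurable_L1_funB.
- apply: measurableT_comp => //; apply/measurable_EFinP.
  exact: measurable_funB.
- by apply: filterS2 Fg Fg' => z /= + + _ => -> // ->.
Qed.

(** The cuts themselves may have infinite measure; the difference with the cut of
    a base point is integrable. *)
Lemma cuts_embed_L1 (X : Type) (x0 : X) (A : X -> set Z) :
  (forall x, measurable (A x)) ->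
  (forall x y, mu (A x `+` A y) < +oo)%E ->
  exists f : X -> L1 mu, forall x y, (mdist (f x) (f y))%:E = mu (A x `+` A y).
Proof.
move=> mA A_fin.
have indicY x y z : `|(\1_(A x) z - \1_(A y) z)%:E|%E = (\1_(A x `+` A y) z)%:E :> \bar R.
  rewrite !indicE /setY in_setU !in_setD.
  by case: (z \in A x) (z \in A y) => -[]/=;
    rewrite ?subrr ?subr0 ?sub0r ?normrN ?normr1 ?normr0.
have mAA x y : measurable (A x `+` A y).
  by apply: measurableU; apply: measurableD.
pose g x : Z -> R := \1_(A x) \- \1_(A x0).
have mg x : measurable_fun setT (g x) by apply: measurable_funB; exact: measurable_indic.
have intE x y : (\int[mu]_z `|(\1_(A x) z - \1_(A y) z)%:E|)%E = mu (A x `+` A y).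
  under eq_integral do rewrite indicY.
  by rewrite integral_indic// setIT.
have /choice[f fP] : forall x, exists F : L1 mu, L1_fun F = g x %[ae mu].
  by move=> x; apply: exists_L1_class => //; rewrite intE.
exists f => x y; rewrite (L1_dist_ae (mg x) (mg y) (fP x) (fP y)) -intE.
apply: eq_integral => z _; congr (`|_%:E|)%E; rewrite /g /=; ring.
Qed.

End CutEmbedding.

Section SumOfCuts.
Context d (Z : measurableType d) (R : realType) (mu : {measure set Z -> \bar R}).
Variable n : nat.

Let slice i : set (nat * Z) -> \bar R := fun B => mu (xsection B i).

Let slice0 i : slice i set0 = 0%E.
Proof. by rewrite /slice xsection0 measure0. Qed.

Let slice_ge0 i B : (0 <= slice i B)%E.
Proof. exact: measure_ge0. Qed.

Let slice_semi_sigma_additive i : semi_sigma_additive (slice i).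
Proof.
move=> F mF tF mUF; rewrite /slice xsection_bigcup.
apply: measure_semi_sigma_additive.
- by move=> k; exact: measurable_xsection.
- exact: trivIset_xsection.
- by rewrite -xsection_bigcup; exact: measurable_xsection.
Qed.

HB.instance Definition _ i := isMeasure.Build _ _ _ (slice i)
  (slice0 i) (@slice_ge0 i) (@slice_semi_sigma_additive i).

(** Placing copies of a measure space side by side adds up the distances given by
    several families of cuts. *)
Lemma sum_of_cuts_measure : exists nu : {measure set (nat * Z) -> \bar R},
  forall A : nat -> set Z, nu [set z | A z.1 z.2] = (\sum_(i < n) mu (A i))%E.
Proof.
exists (msum slice n) => A; apply: eq_bigr => i _; congr (mu _).
by apply/seteqP; split=> z; rewrite xsectionP.
Qed.

End SumOfCuts.

(** * How often the random cut separates two points *)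

Lemma measurable_fun_addb d (T : measurableType d) (f g : T -> bool) :
  measurable_fun setT f -> measurable_fun setT g ->
  measurable_fun setT (fun t => f t (+) g t).
Proof.
move=> mf mg; apply: (@measurable_fun_bool _ _ _ _ true).
have mE (h : T -> bool) b : measurable_fun setT h -> measurable (h @^-1` [set b]).
  by move=> mh; rewrite -[X in measurable X]setTI; exact: mh.
have -> : setT `&` (fun t => f t (+) g t) @^-1` [set true] =
    (f @^-1` [set true] `&` g @^-1` [set false]) `|`
    (f @^-1` [set false] `&` g @^-1` [set true]).
  apply/seteqP; split=> t /=; first by case: (f t) (g t) => -[] [] //= _; [left|right].
  by case: (f t) (g t) => -[] //= [] [].
by apply: measurableU; apply: measurableI; exact: mE.
Qed.

(** In terms of the cells of the next level, the digit is a matter of parity. *)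
Lemma measurable_digit (R : realType) (e j : int) :
  measurable_fun setT (digit e j : measurableTypeR R -> bool).
Proof.
apply: (@measurable_fun_bool _ _ _ _ true).
have [k kE] := @cell_succ R e j.
have -> : setT `&` digit e j @^-1` [set true] =
    \bigcup_(n : int) [set s : measurableTypeR R | cell e (j + 1) s = 2 * n + k + 1].
  apply/seteqP; split=> s /=; first by move=> [_ D]; exists (cell e j s); rewrite //= (kE s).1 D.
  move=> [n _]; rewrite /= (kE s).1 => H; split=> //; move: H.
  by case: (digit e j s) => //=; lia.
apply: countable_bigcupT_measurable => // n; exact: measurable_cell.
Qed.

Section RandomCut.
Context {R : realType} {X : metricType R} (u : X -> R) (x0 : X) (e : int).
Context d (Om : measurableType d) (P : probability Om R) (coin : set X -> Om -> bool).
Hypothesis measurable_coin : forall W, measurable_fun setT (coin W).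
Hypothesis fair_coin : forall W W', W != W' ->
  P [set w | coin W w != coin W' w] = (2^-1)%:E.

Let Z : measurableType _ := (Om * measurableTypeR R)%type.
Let mu : {measure set Z -> \bar R} := (P \x lebesgue_measure)%E.

Definition random_cut x : set Z := [set z | above u x0 e (coin^~ z.1) x z.2].

Lemma measurable_random_cut x : measurable (random_cut x).
Proof.
pose agrees j : set Z := [set z | digit e j z.2 == code u x0 e (coin^~ z.1) j x].
have m_agrees j : measurable (agrees j).
  pose D (z : Z) := digit e j z.2 (+) (digit e j (u x) (+)
    (coin (label u e j x) z.1 (+) coin (label u e j x0) z.1)).
  have mD : measurable_fun setT D.
    apply: measurable_fun_addb.
      exact: (measurableT_comp (@measurable_digit R e j) measurable_snd).
    apply: measurable_fun_addb; first exact: measurable_cst.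
    by apply: measurable_fun_addb;
      exact: (measurableT_comp (@measurable_coin _) measurable_fst).
  rewrite (_ : agrees j = setT `&` D @^-1` [set false]); first exact: mD.
  apply/seteqP; split=> z; rewrite /agrees /D /= /code /flip.
    by move=> /eqP ->; rewrite addbb.
  by move=> [_]; set b := (digit e j (u x) (+) _); case: (digit e j z.2) b => -[].
have -> : random_cut x = \bigcup_(j in [set j : int | digit e j (u x)])
    ((\bigcap_(i in [set i : int | i < j]) agrees i) `\` agrees j).
  apply/seteqP; split=> z /=.
    move=> [j [act /negP ex] dj]; exists j => //; split=> // i ij.
    by rewrite /agrees/= act.
  move=> [j dj [act ex]]; exists j => //; split; last exact/negP.
  by move=> i ij; apply/eqP/act.
rewrite bigcup_mkcond; apply: countable_bigcupT_measurable => [|j].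
  exact: (@countableP int).
case: ifP => // _; apply: measurableD => //.
rewrite -[X in measurable X]setCK setC_bigcap; apply: measurableC.
rewrite bigcup_mkcond; apply: countable_bigcupT_measurable => [|i].
  exact: (@countableP int).
by case: ifP => // _; exact: measurableC.
Qed.

Let m_sep x y : measurable (random_cut x `+` random_cut y).
Proof. by apply: measurableU; apply: measurableD; exact: measurable_random_cut. Qed.

(** The bound holds for every outcome of the coins, by [above_close] and
    [active_cell]. *)
Lemma random_cut_le x y k : `|u x - u y| <= mdist x y -> mdist x y <= 2 ^ (- k) ->
  (mu (random_cut x `+` random_cut y) <= (2 * 2 ^ (- k))%:E)%E.
Proof.
move=> uxy xyk.
have sec w : (lebesgue_measure (xsection (random_cut x `+` random_cut y) w) <=
    (2 * 2 ^ (- k))%:E)%E.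
  have [s sE] := active_cell u x0 e (coin^~ w) k x.
  have [t tE] := active_cell u x0 e (coin^~ w) k y.
  have mc := @measurable_cell R e k.
  rewrite (@le_trans _ _ (lebesgue_measure ([set r : measurableTypeR R | cell e k r = cell e k s]
     `|` [set r : measurableTypeR R | cell e k r = cell e k t]))%E)//.
    apply: le_measure; rewrite ?inE; [exact: measurable_xsection|exact: measurableU|].
    rewrite -sE -tE => r; rewrite xsectionP => xy; apply: contrapT => /not_orP[nx ny].
    have := above_close uxy xyk nx ny; move: xy; rewrite /random_cut /setY/=; tauto.
  rewrite (le_trans (measureU2 _ _ _))//.
  by rewrite /= !lebesgue_cell -EFinD lee_fin; lra.
rewrite /mu/= /product_measure1.
rewrite (@le_trans _ _ (\int[P]_w (cst (2 * 2 ^ (- k))%:E w))%E)//.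
  by apply: ge0_le_integral => // [|w _]; [exact: measurable_fun_xsection|exact: sec].
by rewrite integral_cst//= probability_setT mule1.
Qed.

(** The cell of [separating_cell] is available on the event that two given coins
    differ, whose probability is one half. *)
Lemma random_cut_ge x y k : cell e k (u x) = cell e k (u y) ->
    12^-1 <= rel_pos e k (u y) <= 11 / 12 -> ~ joined u e k x y ->
  ((2^-1 * 2 ^ (- (k + 4)))%:E <= mu (random_cut x `+` random_cut y))%E.
Proof.
move=> Ek yk nj; have [j lxy sep] := separating_cell x0 Ek yk nj.
pose E := [set w | coin (label u e j x) w != coin (label u e j y) w].
have mE : measurable E.
  have := measurable_fun_addb (measurable_coin (label u e j x)) (measurable_coin (label u e j y)).
  move=> /(_ measurableT [set true] I); rewrite setTI; congr measurable.
  apply/seteqP; split=> w; rewrite /E /=; case: (coin _ w) (coin _ w) => -[] //.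
have PE : P E = (2^-1)%:E by apply: fair_coin; exact/eqP.
have sec w : ((2 ^ (- (k + 4)))%:E * (\1_E w)%:E <=
    lebesgue_measure (xsection (random_cut x `+` random_cut y) w))%E.
  rewrite indicE; have [/set_mem Ew|_] := boolP (w \in E); last by rewrite mule0.
  have [l [t [lk lt]]] := sep (coin^~ w) Ew.
  rewrite mule1 (@le_trans _ _ (lebesgue_measure
      [set s : measurableTypeR R | cell e (l + 1) s = cell e (l + 1) t]))//.
    by rewrite lebesgue_cell lee_fin le_pow2N//; lia.
  apply: le_measure; rewrite ?inE; [exact: measurable_cell|exact: measurable_xsection|].
  move=> s /lt; rewrite xsectionP /random_cut /setY /=.
  have [?|?] := pselect (above u x0 e (coin^~ w) x s);
    have [?|?] := pselect (above u x0 e (coin^~ w) y s); tauto.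
rewrite /mu/= /product_measure1 mulrC EFinM -PE.
rewrite -(setIT E) -(integral_indic P measurableT mE) -ge0_integralZl_EFin//; last 2 first.
  by apply/measurable_EFinP; exact: measurable_indic.
  by rewrite ltW ?pow2_gt0.
apply: ge0_le_integral => //.
- by move=> w _; rewrite -EFinM lee_fin mulr_ge0// ltW ?pow2_gt0.
- by apply/measurable_EFinP; apply: measurable_funM => //; exact: measurable_indic.
- exact: measurable_fun_xsection.
Qed.

End RandomCut.

(** * From the geometric hypothesis to the embedding *)

Lemma mdist_realE (R : realType) (s t : R^o) : mdist s t = `|t - s|.
Proof. by []. Qed.

Lemma diam_itv_cc (R : realType) (a b : R) : a <= b ->
  diam (`[a, b]%classic : set R^o) = (b - a)%:E.
Proof.
move=> ab; rewrite /diam; set D := [set _ | _ in _].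
suff -> : ereal_sup D = (b - a)%:E by apply/max_idPr; rewrite lee_fin subr_ge0.
apply/eqP; rewrite eq_le; apply/andP; split.
  apply: ge_ereal_sup => _ [[s t] /= [+ +] <-]; rewrite !in_itv/= => /andP[? ?] /andP[? ?].
  by rewrite lee_fin mdist_realE ler_norml; apply/andP; split; lra.
apply: ereal_sup_ubound; exists (a, b); first by split; rewrite /= in_itv/= lexx ab.
by rewrite /= mdist_realE ger0_norm// subr_ge0.
Qed.

Lemma mdist_le_diam (R : realType) (X : metricType R) (A : set X) x y :
  A x -> A y -> ((mdist x y)%:E <= diam A)%E.
Proof.
move=> Ax Ay; rewrite /diam le_max; apply/orP; right.
by apply: ereal_sup_ubound; exists (x, y).
Qed.

Lemma joined_delta_joined (R : realType) (X : metricType R) (u : X -> R) (e k : int)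
    (W : set X) x y :
  (forall z, cell e k (u z) = cell e k (u x) -> W z) -> joined u e k x y ->
  delta_joined (2 ^ (- k))%:E W x y.
Proof.
move=> xW [l lP <-]; exists l => //; split.
  elim: l x xW lP => [|a l IH] x xW /=.
    by move=> _ z; rewrite inE => /eqP ->; apply: xW.
  move=> /andP[/andP[_ /eqP E] lP] z; rewrite inE => /orP[/eqP ->|]; first exact: xW.
  by apply: IH lP z => z'; rewrite -E; exact: xW.
by apply: sub_path lP => a b /andP[ab _]; rewrite lee_fin.
Qed.

(** The closed interval spanned by a cell has the same diameter as the cell and
    attains it. *)
Lemma joined_dist (R : realType) (X : metricType R) (u : X -> R) (C : R)
    (diam_components : forall I : set R^o, is_interval I ->
      forall A : set X, delta_component (diam I) (u @^-1` I) A ->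
        (diam A <= C%:E * diam I)%E) (e k : int) x y :
  joined u e k x y -> mdist x y <= C * 2 ^ (- k).
Proof.
move=> xy; pose n := cell e k (u x).
pose I : set R^o := `[2 ^ (- k) * (n%:~R + offset e k),
  2 ^ (- k) * (n%:~R + offset e k + 1)]%classic.
have dI : diam I = (2 ^ (- k))%:E.
  rewrite diam_itv_cc; first by congr (_%:E); ring.
  by rewrite ler_pM2l ?pow2_gt0// lerDl.
have WI z : cell e k (u z) = n -> (u @^-1` I) z.
  move=> zn; have : [set s | cell e k s = n] (u z) by [].
  by rewrite cell_itv; apply: subset_itvl; rewrite bnd_simp.
pose A : set X := [set z | delta_joined (diam I) (u @^-1` I) x z].
have Ax : A x.
  by exists [::] => //; split=> // z; rewrite inE => /eqP ->; exact: WI.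
have Ay : A y by rewrite /A/= dI; exact: joined_delta_joined xy.
have := @diam_components I (@interval_is_interval _ _) A.
rewrite dI -EFinM => /(_ _)/(le_trans (mdist_le_diam Ax Ay)); rewrite lee_fin; apply.
by exists x; [exact: WI|rewrite /A dI].
Qed.

Section LevelCut.
Context {R : realType} {X : Type} (u : X -> R).
Context d (Om : measurableType d) (P : probability Om R).
Let mu : {measure set (Om * measurableTypeR R) -> \bar R} :=
  (P \x lebesgue_measure)%E.

Definition level_cut x : set (Om * measurableTypeR R) := setT `*` `]-oo, u x[%classic.

Lemma measurable_level_cut x : measurable (level_cut x).
Proof. by apply: measurableX => //; exact: measurable_itv. Qed.

Lemma level_cutE x y : mu (level_cut x `+` level_cut y) = `|u x - u y|%:E.
Proof.
wlog xy : x y / u x <= u y.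
  move=> H; have [/H//|/ltW/H] := leP (u x) (u y).
  by rewrite setYC distrC.
have -> : level_cut x `+` level_cut y = setT `*` `[u x, u y[%classic.
  have cutE z w s : level_cut z (w, s) <-> s < u z.
    by rewrite /level_cut/= in_itv/=; tauto.
  apply/seteqP; split=> -[w s] /=.
    rewrite in_itv/= => -[[/cutE sx /cutE sy]|[/cutE sy /cutE sx]]; first lra.
    by split=> //; rewrite sy andbT leNgt; exact/negP.
  rewrite in_itv/= => -[_ /andP[xs sy]]; right; split; first exact/cutE.
  by move=> /cutE; lra.
rewrite /mu /= product_measure1E//= probability_setT mul1e.
rewrite lebesgue_measure_itv/= lte_fin distrC ger0_norm ?subr_ge0//.
by case: ltP => // yx; congr (_%:E); lra.
Qed.

End LevelCut.

Unset Implicit Arguments.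

Theorem theorem1p7 (R : realType) (X : metricType R) (u : X -> R^o) (C : R)
    (u_lip : klipschitz 1 u) (C_gt0 : 0 < C)
    (diam_components : forall I : set R^o, is_interval I ->
      forall A : set X, delta_component (diam I) (u @^-1` I) A ->
        (diam A <= C%:E * diam I)%E) :
  exists (d : measure_display) (Z : measurableType d)
    (mu : {measure set Z -> \bar R}) (f : X -> L1 mu),
    bilipschitz_embedding f.
Proof.
(* Without a base point there is nothing to embed. *)
have [[x0 _]|X0] := pselect (exists x : X, True); last first.
  have f (x : X) : L1 (@lebesgue_measure R) by exfalso; apply: X0; exists x.
  by do 3 eexists; exists f; exists 1 => // x; exfalso; apply: X0; exists x.
have [dO [Om [P [coin [m_coin fair_coin]]]]] := exists_fair_coins R (set X).
pose mu : {measure set (Om * measurableTypeR R) -> \bar R} := (P \x lebesgue_measure)%E.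
pose cut (i : nat) (x : X) : set (Om * measurableTypeR R) :=
  match i with
  | 0 => random_cut u x0 0 coin x
  | 1 => random_cut u x0 1 coin x
  | _ => level_cut (u : X -> R) x
  end%N.
have [nu nuE] := sum_of_cuts_measure mu 3.
pose cuts x : set (nat * (Om * measurableTypeR R)) := [set z | cut z.1 x z.2].
have cutsY x y : nu (cuts x `+` cuts y) =
    (mu (random_cut u x0 0 coin x `+` random_cut u x0 0 coin y) +
    mu (random_cut u x0 1 coin x `+` random_cut u x0 1 coin y) + `|u x - u y|%:E)%E.
  rewrite (nuE (fun i => cut i x `+` cut i y)) !big_ord_recl big_ord0 adde0 addeA/=.
  by congr (_ + _)%E; exact: level_cutE.
have m_cut i x : measurable (cut i x).
  by case: i => [|[|i]]; [exact: measurable_random_cut..|exact: measurable_level_cut].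
have m_cuts x : measurable (cuts x).
  rewrite (_ : cuts x = \bigcup_i ([set i] `*` cut i x)).
    by apply: bigcupT_measurable => i; exact: measurableX.
  apply/seteqP; split=> [[i z] xz|[i z] [j _ [/= -> //]]].
  by exists i.
have lip x y : `|u x - u y| <= mdist x y.
  by have := u_lip x y; rewrite mul1r mdist_realE distrC.
have upper x y : x != y -> (nu (cuts x `+` cuts y) <= (9 * mdist x y)%:E)%E.
  rewrite -mdist_gt0 => /dyadic_scale -[m /andP[m1 m2]].
  (* With r = 2 ^ - (m - 1) <= 2 d, each of the two grids contributes at most
     2 r <= 4 d, and the levels of u at most d. *)
  have rm : 2 ^ (- (m - 1)) = 2 * 2 ^ (- m) :> R by rewrite opprB addrC pow2S.
  have xym : mdist x y <= 2 ^ (- (m - 1)) by rewrite rm.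
  have le_cut e := @random_cut_le R X u x0 e _ Om P coin m_coin x y (m - 1) (lip x y) xym.
  rewrite cutsY (le_trans (leeD (leeD (le_cut 0) (le_cut 1)) (lexx _)))//.
  rewrite -!EFinD lee_fin rm; have := lip x y; lra.
have lower x y : x != y -> (((64 * C)^-1 * mdist x y)%:E <= nu (cuts x `+` cuts y))%E.
  rewrite -mdist_gt0 => xy.
  (* A level too fine for x and y to be joined, with cells comparable to d. *)
  have [k] : exists k : int, 2 ^ (- k) < mdist x y / C <= 2 * 2 ^ (- k).
    by apply: dyadic_scale; rewrite divr_gt0.
  rewrite ltr_pdivlMr// ler_pdivrMr// => /andP[k1 k2].
  have kxy : (64 * C)^-1 * mdist x y <= 2 ^ (- k) / 32.
    by rewrite ler_pdivrMl ?mulr_gt0//; lra.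
  have not_joined e : ~ joined (u : X -> R) e k x y.
    move=> /(joined_dist diam_components); apply/negP; rewrite -ltNge.
    by rewrite mulrC.
  rewrite cutsY; have [uxy|uxy] := leP (2 ^ k * `|u x - u y|) 12^-1.
    have [e e01 [Ek yk]] := well_placed_grid uxy.
    have := random_cut_ge x0 m_coin fair_coin Ek yk (not_joined e).
    have -> : 2^-1 * 2 ^ (- (k + 4)) = 2 ^ (- k) / 32 :> R.
      by rewrite opprD expfzDr// (_ : 2 ^ (- 4%:Z) = 16^-1 :> R); [lra|rewrite pow2N -exprnP; lra].
    move=> /(le_trans (_ : (_ <= _)%E)) ge_cut.
    have {}ge_cut : (((64 * C)^-1 * mdist x y)%:E <=
        mu (random_cut u x0 e coin x `+` random_cut u x0 e coin y))%E.
      by apply: ge_cut; rewrite lee_fin.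
    apply: (le_trans _ (leeDl _ _)); last by rewrite lee_fin.
    by case: e01 ge_cut => -> ge_cut; apply: le_trans ge_cut _;
      [rewrite leeDl|rewrite leeDr].
  apply: (le_trans _ (leeDr _ _)); last by apply: adde_ge0; exact: measure_ge0.
  rewrite lee_fin (le_trans kxy)//; have := pow2_gt0 (R := R) k.
  rewrite pow2N; set p := 2 ^ k => p0.
  have : p^-1 * 12^-1 < `|u x - u y| by rewrite ltr_pdivrMl// mulrC in uxy *.
  by have : 0 < p^-1; [rewrite invr_gt0|lra].
have cuts_fin x y : (nu (cuts x `+` cuts y) < +oo)%E.
  have [->|xy] := eqVneq x y; first by rewrite setYK measure0.
  by rewrite (le_lt_trans (upper x y xy))// ltry.
have [f fE] := cuts_embed_L1 x0 m_cuts cuts_fin.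
exists _, _, nu, f, (Num.max 9 (64 * C)).
  by rewrite le_max; apply/orP; left; lra.
move=> x y; have [->|xy] := eqVneq x y; first by rewrite !mdistxx !mulr0 lexx.
rewrite -!lee_fin fE; apply/andP; split.
  apply: le_trans (lower x y xy); rewrite lee_fin ler_wpM2r ?mdist_ge0//.
  have C64_gt0 : 0 < 64 * C by lra.
  by rewrite lef_pV2 ?posrE ?lt_max ?C64_gt0 ?orbT// le_max lexx orbT.
apply: le_trans (upper x y xy) _; rewrite lee_fin ler_wpM2r ?mdist_ge0//.
by rewrite le_max lexx.
Qed.
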